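(* Let $S$ be an abelian group. Define a linear map $\pi:\mathcal{L}_S\to\mathfrak{gl}_S$ by $$\pi(L_{\alpha,\beta})=E_{\alpha+\beta,\beta-\alpha}\quad\text{for }\alpha,\beta\in S.$$ Then $\pi$ is a homomorphism of associative algebras, which commutes with the actions of $S$ and $\tau$. Furthermore, if $S^0=0$, then $\pi$ is one-to-one and preserves the bilinear forms. If $S^0=0$ and $S=2S$, then $\pi$ is an isomorphism. Especially, if $S$ is finite of odd order, then $\pi$ is an algebra isomorphism.
   Context: All vector spaces are over $\mathbb{C}$; $S$ is written additively, $S^0=\{\alpha\in S\mid 2\alpha=0\}$, $2S=\{2\alpha\mid\alpha\in S\}$. $\mathcal{L}_S$ is the associative algebra with basis $\{L_{\alpha,\beta}\mid\alpha,\beta\in S\}$ and product $L_{\alpha,\beta}L_{\mu,\nu}=\delta_{\alpha+\mu,\beta-\nu}L_{\alpha+\mu,\alpha+\nu}$, with bilinear form $\langle L_{\alpha,\beta},L_{\mu,\nu}\rangle=\delta_{\alpha+\mu,0}\delta_{\beta,\nu}$; $\gamma\in S$ acts by $\sigma_\gamma(L_{\alpha,\beta})=L_{\alpha,\beta+\gamma}$, and $\tau$ is the Lie algebra automorphism (for the commutator bracket) $\tau(L_{\alpha,\beta})=-L_{-\alpha,\beta}$. $\mathfrak{gl}_S$ is the associative algebra with basis $\{E_{\alpha,\beta}\mid\alpha,\beta\in S\}$ and product $E_{\alpha,\beta}E_{\mu,\nu}=\delta_{\beta,\mu}E_{\alpha,\nu}$, with bilinear form $\langle E_{\alpha,\beta},E_{\mu,\nu}\rangle=\delta_{\alpha,\nu}\delta_{\beta,\mu}$;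 $\gamma\in S$ acts by $\sigma_\gamma(E_{\alpha,\beta})=E_{\alpha+\gamma,\beta+\gamma}$, and $\tau$ is the Lie algebra automorphism $\tau(E_{\alpha,\beta})=-E_{\beta,\alpha}$. *)

(* Defs.v *)
From HB Require Import structures.
From mathcomp Require Import all_boot all_order all_algebra.
From mathcomp Require Import finmap monalg complex.
From mathcomp Require Import boolp classical_sets functions cardinality reals.

Set Implicit Arguments.
Unset Strict Implicit.
Unset Printing Implicit Defensive.

Import GRing.Theory.

Local Open Scope classical_set_scope.
Local Open Scope ring_scope.

(* Associative algebras without unit: L_S and gl_S have no unit when S is
   infinite, so MathComp's algType does not apply to them. *)
HB.mixin Record Lmodule_isAssocAlgebra (K : comNzRingType) A
    of GRing.Lmodule K A := {
  amul : A -> A -> A;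
  amulA : associative amul;
  amul_linearl : forall y, linear (amul ^~ y);
  amul_linearr : forall x, linear (amul x)
}.

#[short(type="assocAlgType")]
HB.structure Definition AssocAlgebra (K : comNzRingType) :=
  { A of GRing.Lmodule K A & Lmodule_isAssocAlgebra K A }.

Definition assoc_alg_hom (K : comNzRingType) (A B : assocAlgType K)
    (f : A -> B) : Prop :=
  linear f /\ {morph f : x y / amul x y}.

Definition assoc_alg_iso (K : comNzRingType) (A B : assocAlgType K)
    (f : A -> B) : Prop :=
  assoc_alg_hom f /\ bijective f.

(* {malg K[I]} is the free K-module with basis << i >>, i : I. *)
Section LinearExtension.
Context {K : comNzRingType} {I : choiceType}.

Definition lin_ext (V : lmodType K) (f : I -> V) (x : {malg K[I]}) : V :=
  \sum_(i <- msupp x) x@_i *: f i.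

Definition bilin_ext (V : lmodType K) (f : I -> I -> V)
    (x y : {malg K[I]}) : V :=
  lin_ext (fun i => lin_ext (f i) y) x.

Lemma lin_ext_wide (V : lmodType K) (f : I -> V) (x : {malg K[I]})
    (d : {fset I}) :
  (msupp x `<=` d)%fset -> lin_ext f x = \sum_(i <- d) x@_i *: f i.
Proof.
move=> sxd; rewrite /lin_ext; apply: big_fset_incl => // i _.
by move/mcoeff_outdom ->; rewrite scale0r.
Qed.

Lemma lin_ext_is_linear (V : lmodType K) (f : I -> V) : linear (lin_ext f).
Proof.
move=> a x y; pose d := (msupp x `|` msupp y `|` msupp (a *: x + y))%fset.
have sub z : z \in [:: x; y; a *: x + y] -> (msupp z `<=` d)%fset.
  rewrite !inE => /or3P[] /eqP->; apply/fsubsetP => i; rewrite !inE.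
  - by move->.
  - by move->; rewrite orbT.
  - by move->; rewrite orbT.
rewrite !(@lin_ext_wide V f _ d) ?sub ?inE ?eqxx ?orbT //.
rewrite scaler_sumr -big_split /=; apply: eq_bigr => i _.
by rewrite mcoeffD mcoeffZ scalerDl scalerA.
Qed.

HB.instance Definition _ (V : lmodType K) (f : I -> V) :=
  GRing.isLinear.Build K {malg K[I]} V *:%R (lin_ext f) (lin_ext_is_linear f).

Lemma lin_extE (V : lmodType K) (f : I -> V) (i : I) :
  lin_ext f << i >> = f i.
Proof.
rewrite (@lin_ext_wide V f _ [fset i]%fset) ?msuppU_le //.
by rewrite big_seq_fset1 mcoeffUU scale1r.
Qed.

Lemma bilin_extE (V : lmodType K) (f : I -> I -> V) (i j : I) :
  bilin_ext f << i >> << j >> = f i j.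
Proof. by rewrite /bilin_ext !lin_extE. Qed.

Lemma bilin_ext_linearl (V : lmodType K) (f : I -> I -> V) y :
  linear ((bilin_ext f) ^~ y).
Proof. exact: lin_ext_is_linear. Qed.

Lemma bilin_ext_linearr (V : lmodType K) (f : I -> I -> V) x :
  linear (bilin_ext f x).
Proof.
move=> a y z; rewrite /bilin_ext /lin_ext scaler_sumr -big_split /=.
apply: eq_bigr => i _; rewrite -!/(lin_ext _ _) linearP scalerDr.
by rewrite !scalerA mulrC.
Qed.

Lemma bilin_extZl (V : lmodType K) (f : I -> I -> V) a x y :
  bilin_ext f (a *: x) y = a *: bilin_ext f x y.
Proof. exact: linearZ. Qed.

Lemma bilin_extZr (V : lmodType K) (f : I -> I -> V) a x y :
  bilin_ext f x (a *: y) = a *: bilin_ext f x y.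
Proof.
pose m := GRing.isLinear.Build _ _ _ _ _ (@bilin_ext_linearr V f x).
pose g : {linear _ -> _} := HB.pack (bilin_ext f x) m.
exact: (linearZ_LR g).
Qed.

Lemma malg_lin_ext (x : {malg K[I]}) : x = lin_ext (fun i => << i >>) x.
Proof.
rewrite {1}(monalgE x) /lin_ext; apply: eq_bigr => i _; apply/malgP => j.
by rewrite mcoeffZ !mcoeffU mulr_natr.
Qed.

Lemma linear_lin_ext (V : lmodType K) (g : {malg K[I]} -> V) :
  linear g -> g =1 lin_ext (fun i => g << i >>).
Proof.
move=> lg x; pose mg := GRing.isLinear.Build _ _ _ _ g lg.
pose g' : {linear _ -> _} := HB.pack g mg.
transitivity (g' (lin_ext (fun i => << i >>) x)).
  by rewrite -malg_lin_ext.
rewrite [in LHS]/lin_ext raddf_sum.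
by apply: eq_bigr => i _; exact: (linearZ_LR g').
Qed.

Lemma linear_ext (V : lmodType K) (g h : {malg K[I]} -> V) :
  linear g -> linear h -> (forall i, g << i >> = h << i >>) -> g =1 h.
Proof.
move=> lg lh gh x; rewrite (linear_lin_ext lg) (linear_lin_ext lh).
by apply: eq_bigr => i _; rewrite gh.
Qed.

Lemma bilin_extA (f : I -> I -> {malg K[I]}) :
  (forall i j k, bilin_ext f << i >> (f j k) = bilin_ext f (f i j) << k >>) ->
  associative (bilin_ext f).
Proof.
move=> fA x y z; set m := bilin_ext f.
have ll := @bilin_ext_linearl _ f; have lr := @bilin_ext_linearr _ f.
move: x; apply: linear_ext => [|a u v|i]; first exact: ll.
  by rewrite /m !ll.
move: y; apply: linear_ext => [a u v|a u v|j].
- by rewrite /m ll lr.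
- by rewrite /m lr ll.
move: z; apply: linear_ext => [a u v||k]; last by rewrite /m !bilin_extE fA.
  by rewrite /m !lr.
exact: lr.
Qed.

End LinearExtension.

Section Algebras.
Context (R : realType) (S : zmodType).
(* The field of complex numbers: a realType is determined up to isomorphism. *)
Local Notation C := (R[i]).

Definition LS : Type := {malg C[(S * S)%type]}.
HB.instance Definition _ := GRing.Lmodule.copy LS {malg C[(S * S)%type]}.

Definition Lb (a b : S) : LS := << (a, b) >>.

Definition LS_mul : LS -> LS -> LS :=
  bilin_ext (fun k l : S * S =>
    (k.1 + l.1 == k.2 - l.2)%:R *: Lb (k.1 + l.1) (k.1 + l.2)).

Lemma LS_mulA : associative LS_mul.
Proof.
apply: bilin_extA => -[a b] [m n] [r s] /=.
rewrite bilin_extZl bilin_extZr !bilin_extE /= !scalerA -!natrM !mulnb !addrA.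
have [e1|ne1] := eqVneq (m + r) (n - s).
  have es : s = n - m - r by rewrite -addrA -opprD e1 opprB addrCA subrr addr0.
  have -> : a + m + s = a + n - r by rewrite es !addrA (addrAC a) addrK.
  have -> : (a + m + r == b - (m + s)) = (a + m == b - n).
    rewrite -[in RHS](inj_eq (addIr r)); congr (_ == _).
    by rewrite es addrA (addrC m) subrK opprB addrA addrAC.
  have -> : (a + m + r == a + n - s) by rewrite -!addrA e1.
  by rewrite andbT.
rewrite (_ : (a + m + r == a + n - s) = false) ?andbF //.
by apply: contraNF ne1; rewrite -!addrA (inj_eq (addrI a)).
Qed.

HB.instance Definition _ := Lmodule_isAssocAlgebra.Build C LS
  LS_mulA (@bilin_ext_linearl _ _ _ _) (@bilin_ext_linearr _ _ _ _).

Definition LS_form : LS -> LS -> C :=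
  @bilin_ext _ _ C^o (fun k l : S * S =>
    ((k.1 + l.1 == 0) && (k.2 == l.2))%:R).

Definition LS_sigma (g : S) : LS -> LS :=
  lin_ext (fun k : S * S => Lb k.1 (k.2 + g)).

Definition LS_tau : LS -> LS :=
  lin_ext (fun k : S * S => - Lb (- k.1) k.2).

Definition glS : Type := {malg C[(S * S)%type]}.
HB.instance Definition _ := GRing.Lmodule.copy glS {malg C[(S * S)%type]}.

Definition Eb (a b : S) : glS := << (a, b) >>.

Definition glS_mul : glS -> glS -> glS :=
  bilin_ext (fun k l : S * S => (k.2 == l.1)%:R *: Eb k.1 l.2).

Lemma glS_mulA : associative glS_mul.
Proof.
apply: bilin_extA => -[a b] [m n] [r s] /=.
by rewrite bilin_extZl bilin_extZr !bilin_extE /= !scalerA mulrC.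
Qed.

HB.instance Definition _ := Lmodule_isAssocAlgebra.Build C glS
  glS_mulA (@bilin_ext_linearl _ _ _ _) (@bilin_ext_linearr _ _ _ _).

Definition glS_form : glS -> glS -> C :=
  @bilin_ext _ _ C^o (fun k l : S * S =>
    ((k.1 == l.2) && (k.2 == l.1))%:R).

Definition glS_sigma (g : S) : glS -> glS :=
  lin_ext (fun k : S * S => Eb (k.1 + g) (k.2 + g)).

Definition glS_tau : glS -> glS :=
  lin_ext (fun k : S * S => - Eb k.2 k.1).

Definition LS_to_glS : LS -> glS :=
  lin_ext (fun k : S * S => Eb (k.1 + k.2) (k.2 - k.1)).

Lemma LS_amulE (a b m n : S) :
  amul (Lb a b) (Lb m n) = (a + m == b - n)%:R *: Lb (a + m) (a + n).
Proof. exact: bilin_extE. Qed.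

Lemma glS_amulE (a b m n : S) :
  amul (Eb a b) (Eb m n) = (b == m)%:R *: Eb a n.
Proof. exact: bilin_extE. Qed.

Lemma LS_to_glSE (a b : S) : LS_to_glS (Lb a b) = Eb (a + b) (b - a).
Proof. exact: lin_extE. Qed.

End Algebras.

Definition torsion2 (S : zmodType) : set S := [set a | a *+ 2 = 0].
Arguments torsion2 S : clear implicits.

Definition twice (S : zmodType) : set S := [set a *+ 2 | a in [set: S]].
Arguments twice S : clear implicits.

(* Main.v *)
Require Import Defs.
From HB Require Import structures.
From mathcomp Require Import all_boot all_order all_algebra.
From mathcomp Require Import finmap monalg complex.
From mathcomp Require Import boolp classical_sets functions cardinality reals.
From mathcomp Require Import fsbigop.

(** On basis vectors the map [LS_to_glS] is the substitution
    [(a, b) |-> (a + b, b - a)] of indices. Both products, both forms, the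
    translations and the two maps [tau] are given on basis vectors, so a
    comparison of linear or bilinear maps reduces to an identity between
    indices ([linear_ext], [bilinear_ext]). For the product, [a + m = b - n]
    and [b - a = m + n] are the same condition, and under it the two resulting
    indices agree.

    The substitution has determinant 2 over the integers: the sum of the two
    entries of [(a + b, b - a)] is [2b] ([addr_sum_diff]). Hence it is
    injective once doubling is, and bijective once doubling is a bijection. A
    substitution of indices that is injective (bijective) induces an injective
    (bijective) linear map of free modules ([lin_ext_inj], [lin_ext_bij]). The
    forms are preserved for the same reason: [a + b = n - m] and
    [b - a = m + n] add up to [2b = 2n], so they force [b = n] and [a + m = 0]
    as soon as 2 can be cancelled.

    If [S] has odd order [n], then [n] annihilates [S], so [n + 1] acts as the
    identity and doubling is inverted by multiplication by [(n + 1) / 2]. *)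

Set Implicit Arguments.
Unset Strict Implicit.
Unset Printing Implicit Defensive.

Import GRing.Theory.

Local Open Scope classical_set_scope.
Local Open Scope ring_scope.

Lemma linear_comp (K : comNzRingType) (U V W : lmodType K)
    (f : U -> V) (g : V -> W) :
  linear f -> linear g -> linear (g \o f).
Proof. by move=> lf lg a x y; rewrite /= lf lg. Qed.

Section FreeModule.
Context {K : comNzRingType} {I J : choiceType}.

Lemma bilinear_ext (V : lmodType K) (g h : {malg K[I]} -> {malg K[J]} -> V) :
  (forall y, linear (g^~ y)) -> (forall x, linear (g x)) ->
  (forall y, linear (h^~ y)) -> (forall x, linear (h x)) ->
  (forall i j, g << i >> << j >> = h << i >> << j >>) ->
  forall x y, g x y = h x y.
Proof.
move=> gl gr hl hr gh x y; move: x; apply: linear_ext => // i.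
by move: y; apply: linear_ext => // j.
Qed.

(** Reads off coordinates: distinct basis vectors have distinct images, so
    the coordinate at [h i] of the image only receives the coordinate at
    [i] of the argument. *)
Lemma mcoeff_lin_ext_inj (h : I -> J) (x : {malg K[I]}) i :
  injective h -> (lin_ext (fun i => << h i >> : {malg K[J]}) x)@_(h i) = x@_i.
Proof.
move=> h_inj; pose coef (L : choiceType) k (z : {malg K[L]}) : K^o := z@_k.
have coefP (L : choiceType) (k : L) : linear (@coef L k).
  by move=> a u v; rewrite /coef mcoeffD mcoeffZ.
apply: (linear_ext (g := @coef J (h i) \o _) (h := @coef I i)) => [||j] //.
  by apply: linear_comp; [exact: lin_ext_is_linear | exact: coefP].
by rewrite /= lin_extE /coef !mcoeffU (inj_eq h_inj).
Qed.

Lemma lin_ext_inj (h : I -> J) :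
  injective h -> injective (lin_ext (fun i => << h i >> : {malg K[J]})).
Proof.
move=> h_inj x y exy; apply/malgP => i.
by rewrite -!(mcoeff_lin_ext_inj _ _ h_inj) exy.
Qed.

End FreeModule.

Lemma lin_ext_cancel (K : comNzRingType) (I J : choiceType)
    (h : I -> J) (g : J -> I) :
  cancel h g ->
  cancel (lin_ext (fun i => << h i >> : {malg K[J]}))
         (lin_ext (fun j => << g j >> : {malg K[I]})).
Proof.
move=> hK; apply: (linear_ext (g := lin_ext _ \o lin_ext _) (h := id)) => //.
  by apply: linear_comp; exact: lin_ext_is_linear.
by move=> i; rewrite /= !lin_extE hK.
Qed.

Lemma lin_ext_bij (K : comNzRingType) (I J : choiceType) (h : I -> J) :
  bijective h -> bijective (lin_ext (fun i => << h i >> : {malg K[J]})).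
Proof.
by case=> g hK gK; exists (lin_ext (fun j => << g j >>)); exact: lin_ext_cancel.
Qed.

Section Doubling.
Context (S : zmodType).

Lemma torsion2_inj : torsion2 S = [set 0] -> injective (fun a : S => a *+ 2).
Proof.
move=> S0 a b ab; apply/eqP; rewrite -subr_eq0.
have : torsion2 S (a - b) by rewrite /torsion2 /= mulrnBl ab subrr.
by rewrite S0 => ->.
Qed.

(** Translation by [a] permutes the group, so the sum [s] of all elements
    satisfies [s = s + a *+ n]: Lagrange's theorem without subgroups, thanks to
    commutativity. *)
Lemma finite_zmod_mulrn (n : nat) (a : S) :
  ([set: S] #= `I_n)%card -> a *+ n = 0.
Proof.
move=> Sn; have Sfin : finite_set [set: S] by apply/finite_setP; exists n.
have shift : \sum_(x \in [set: S]) x = \sum_(x \in [set: S]) (x + a).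
  apply: (reindex_fsbigT (fun x : S => x + a)).
  by exists (fun x => x - a) => x; rewrite ?addrK ?subrK.
move/eqP: shift; rewrite fsbig_split //= -subr_eq0 opprD addNKr oppr_eq0.
rewrite fsbig_finite //= big_const_seq iter_addr_0 count_predT.
by rewrite (card_fset_set Sn) => /eqP.
Qed.

Lemma odd_torsion2 (n : nat) :
  (forall a : S, a *+ n = 0) -> odd n -> torsion2 S = [set 0].
Proof.
move=> Sn on; rewrite /torsion2; apply/seteqP.
split=> [a|_ ->] /=; last first.
  by rewrite mul0rn.
move=> a2; have := Sn a.
by rewrite -(odd_double_half n) on add1n mulrS -mul2n mulrnA a2 mul0rn addr0.
Qed.

Lemma odd_twice (n : nat) :
  (forall a : S, a *+ n = 0) -> odd n -> twice S = [set: S].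
Proof.
move=> Sn on; apply/seteqP; split=> // a _; exists (a *+ n.+1./2) => //.
rewrite -mulrnA muln2.
have -> : (n.+1./2.*2 = n.+1)%N.
  by rewrite -[RHS]odd_double_half /= on.
by rewrite mulrS Sn addr0.
Qed.

Lemma addr_sum_diff (a b : S) : (a + b) + (b - a) = b *+ 2.
Proof. by rewrite addrC addrA subrK mulr2n. Qed.

(** The index map of [LS_to_glS]. *)
Definition sum_diff (k : S * S) : S * S := (k.1 + k.2, k.2 - k.1).

Lemma sum_diff_inj : torsion2 S = [set 0] -> injective sum_diff.
Proof.
move=> /torsion2_inj inj2 [a b] [m n] [/= e1 e2].
have ebn : b = n.
  by apply: inj2; rewrite /= -(addr_sum_diff a) e1 e2 addr_sum_diff.
by move: e1; rewrite ebn => /addIr ->.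
Qed.

Lemma sum_diff_bij :
  torsion2 S = [set 0] -> twice S = [set: S] -> bijective sum_diff.
Proof.
move=> S0 S2; rewrite -setTT_bijective; split=> //.
  by move=> k l _ _; exact: sum_diff_inj.
move=> [u v] _; have : twice S (u + v) by rewrite S2.
(* [2b = u + v] is forced by [addr_sum_diff]. *)
case=> b _ buv; exists (u - b, b) => //; rewrite /sum_diff /= subrK.
by congr pair; rewrite opprB addrA -mulr2n buv addrAC subrr add0r.
Qed.

End Doubling.

Section LStoGLS.
Context (R : realType) (S : zmodType).
Local Notation LS := (LS R S).

Lemma LS_to_glS_linear : linear (@LS_to_glS R S).
Proof. exact: lin_ext_is_linear. Qed.

Lemma LS_to_glS_hom : assoc_alg_hom (@LS_to_glS R S).
Proof.
have lpi := LS_to_glS_linear.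
split=> //; apply: (bilinear_ext
  (g := fun x y : LS => LS_to_glS (amul x y))
  (h := fun x y : LS => amul (LS_to_glS x) (LS_to_glS y))).
- by move=> y a u v /=; rewrite amul_linearl lpi.
- by move=> x a u v /=; rewrite amul_linearr lpi.
- by move=> y a u v /=; rewrite lpi amul_linearl.
- by move=> x a u v /=; rewrite lpi amul_linearr.
move=> [a b] [m n]; rewrite -!/(Lb R _ _) LS_amulE !LS_to_glSE glS_amulE.
have -> : (b - a == m + n) = (a + m == b - n).
  by rewrite [RHS]eq_sym !subr_eq addrC addrA.
have [e|_] := eqVneq (a + m) (b - n).
  rewrite !scale1r LS_to_glSE; congr Eb.
    by rewrite e addrCA subrK.
  by rewrite opprD addrACA subrr add0r.
by rewrite !scale0r /LS_to_glS linear0.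
Qed.

Lemma LS_to_glS_sigma (g : S) (x : LS) :
  LS_to_glS (LS_sigma g x) = glS_sigma g (LS_to_glS x).
Proof.
apply: (linear_ext (g := @LS_to_glS R S \o LS_sigma g)
                   (h := glS_sigma g \o @LS_to_glS R S)).
- by apply: linear_comp; exact: lin_ext_is_linear.
- by apply: linear_comp; exact: lin_ext_is_linear.
move=> [a b]; rewrite /= -/(Lb R a b) LS_to_glSE /LS_sigma /glS_sigma.
by rewrite !lin_extE /= LS_to_glSE addrA (addrAC b).
Qed.

Lemma LS_to_glS_tau (x : LS) : LS_to_glS (LS_tau x) = glS_tau (LS_to_glS x).
Proof.
apply: (linear_ext (g := @LS_to_glS R S \o @LS_tau R S)
                   (h := @glS_tau R S \o @LS_to_glS R S)).
- by apply: linear_comp; exact: lin_ext_is_linear.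
- by apply: linear_comp; exact: lin_ext_is_linear.
move=> [a b]; rewrite /= -/(Lb R a b) LS_to_glSE /LS_tau /glS_tau.
rewrite !lin_extE /= /LS_to_glS linearN /= -/(LS_to_glS _) LS_to_glSE.
by rewrite opprK (addrC (- a)) (addrC b a).
Qed.

Lemma LS_to_glS_inj : torsion2 S = [set 0] -> injective (@LS_to_glS R S).
Proof. by move=> S0; apply: lin_ext_inj; exact: sum_diff_inj. Qed.

Lemma LS_to_glS_form (x y : LS) : torsion2 S = [set 0] ->
  glS_form (LS_to_glS x) (LS_to_glS y) = LS_form x y.
Proof.
move=> /torsion2_inj inj2; have lpi := LS_to_glS_linear.
apply: (bilinear_ext (V := R[i]^o)
  (g := fun x y : LS => glS_form (LS_to_glS x) (LS_to_glS y))
  (h := fun x y : LS => LS_form x y)).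
- by move=> z a u v /=; rewrite lpi; exact: bilin_ext_linearl.
- by move=> z a u v /=; rewrite lpi; exact: bilin_ext_linearr.
- exact: bilin_ext_linearl.
- exact: bilin_ext_linearr.
move=> [a b] [m n]; rewrite -!/(Lb R _ _) !LS_to_glSE.
rewrite /glS_form /LS_form !bilin_extE /=; congr (_%:R); congr nat_of_bool.
apply/andP/andP => -[/eqP e1 /eqP e2].
  have ebn : b = n.
    by apply: inj2; rewrite /= -(addr_sum_diff a) e1 e2 addrC addr_sum_diff.
  split; last exact/eqP.
  by move: e1; rewrite ebn addrC => /addrI ->; rewrite addNr.
by rewrite -(addr0_eq e1) e2 opprK (addrC a) (addrC (- a)) !eqxx.
Qed.

Lemma LS_to_glS_iso :
  torsion2 S = [set 0] -> twice S = [set: S] -> assoc_alg_iso (@LS_to_glS R S).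
Proof.
move=> S0 S2; split; first exact: LS_to_glS_hom.
by apply: lin_ext_bij; exact: sum_diff_bij.
Qed.

End LStoGLS.

Theorem proposition5p1 (R : realType) (S : zmodType) :
  [/\ assoc_alg_hom (@LS_to_glS R S),
      (forall (g : S) (x : LS R S),
         LS_to_glS (LS_sigma g x) = glS_sigma g (LS_to_glS x)) /\
      (forall x : LS R S, LS_to_glS (LS_tau x) = glS_tau (LS_to_glS x)),
      torsion2 S = [set 0] ->
        injective (@LS_to_glS R S) /\
        (forall x y : LS R S,
           glS_form (LS_to_glS x) (LS_to_glS y) = LS_form x y),
      torsion2 S = [set 0] -> twice S = [set: S] ->
        assoc_alg_iso (@LS_to_glS R S)
    & forall n : nat, ([set: S] #= `I_n)%card -> odd n ->
        assoc_alg_iso (@LS_to_glS R S)].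
Proof.
split.
- exact: LS_to_glS_hom.
- by split; [exact: LS_to_glS_sigma | exact: LS_to_glS_tau].
- by move=> S0; split=> [|x y]; [exact: LS_to_glS_inj | exact: LS_to_glS_form].
- exact: LS_to_glS_iso.
move=> n Sn on; have nS a : a *+ n = 0 := finite_zmod_mulrn a Sn.
by apply: LS_to_glS_iso; [exact: odd_torsion2 on | exact: odd_twice on].
Qed.
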